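(* Let $(P,\leq,{}',0,1)$ be a bounded poset (least element $0$, greatest element $1$) with a unary operation ${}'$ such that, for all $x,y\in P$, $L(x)\subseteq L(U(L(x,y),y'))$ and $L(U(x,y'),y)\subseteq L(x)$. Define $M,R:P^2\to 2^P$ by $M(x,y)=L(x,y)$ and $R(x,y)=L(U(y,x'))$. Then $(P,\leq,{}',M,R,0,1)$ is an operator residuated poset.
   Context: For a poset $(P,\leq)$ and $A\subseteq P$ let $L(A)=\{x\in P\mid x\leq a\text{ for all }a\in A\}$ and $U(A)=\{x\in P\mid a\leq x\text{ for all }a\in A\}$; write $L(x)=L(\{x\})$, and when several elements or subsets are listed as arguments the union of them is meant, e.g. $L(x,y)=L(\{x,y\})$, $L(U(x,y'),y)=L(U(\{x,y'\})\cup\{y\})$. An operator left residuated poset is an ordered seventuple $(P,\leq,{}',M,R,0,1)$ where $(P,\leq,0,1)$ is a bounded poset, ${}'$ a unary operation on $P$, and $M,R:P^2\to 2^P$ satisfy for all $x,y,z\in P$: (i) $M(x,1)=M(1,x)=L(x)$; (ii) $M(x,y)\subseteq L(z)$ if and only if $L(x)\subseteq R(y,z)$; (iii) $R(x,0)=L(x')$. It is called an operator residuated poset if moreover $M$ is commutative, i.e. $M(x,y)=M(y,x)$ for all $x,y$. *)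

(* Defs.v *)
From mathcomp Require Import all_boot all_order.
From mathcomp Require Import boolp classical_sets.

Set Implicit Arguments.
Unset Strict Implicit.
Unset Printing Implicit Defensive.

Local Open Scope classical_set_scope.
Local Open Scope order_scope.

(* The operators L and U are [lbound] and [ubound]. The bounded poset
   (P, <=, 0, 1) is a [tbPOrderType], with 0 = \bot and 1 = \top; \bot = \top
   is allowed. *)

Record operator_left_residuated (d : Order.disp_t) (P : tbPOrderType d)
    (c : P -> P) (M R : P -> P -> set P) : Prop := {
  olr_unit : forall x : P,
    M x \top = lbound [set x] /\ M \top x = lbound [set x];
  olr_adjoint : forall x y z : P,
    M x y `<=` lbound [set z] <-> lbound [set x] `<=` R y z;
  olr_compl : forall x : P, R x \bot = lbound [set c x]
}.

Record operator_residuated (d : Order.disp_t) (P : tbPOrderType d)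
    (c : P -> P) (M R : P -> P -> set P) : Prop := {
  or_left : operator_left_residuated c M R;
  or_comm : forall x y : P, M x y = M y x
}.

(* Main.v *)
Require Import Defs.
From mathcomp Require Import all_boot all_order.
From mathcomp Require Import boolp classical_sets.

Local Open Scope classical_set_scope.
Local Open Scope order_scope.

Import Order.TTheory.

(** The two hypotheses are the two halves of adjointness: [h1] acts as a unit, placing $L(x)$ inside
    $R(y,\cdot)$ of the cone $L(x,y)$, and [h2] as a counit, bringing $R(y,z)$ cut down by $y$ back
    below $z$. Monotonicity of $LU$ does the rest. The unit laws, commutativity and $R(x,0)=L(x')$
    use only that $0$ and $1$ are the bounds. *)

Lemma lbound1P (d : Order.disp_t) (P : porderType d) (a w : P) :
  lbound [set a] w <-> w <= a.
Proof. by split=> [wa|wa _ ->//]; apply: wa. Qed.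

Lemma lbound2P (d : Order.disp_t) (P : porderType d) (a b w : P) :
  lbound [set a; b] w <-> w <= a /\ w <= b.
Proof.
split=> [wab|[wa wb] _ [->|->]//].
by split; apply: wab; [left|right].
Qed.

Lemma ubound2P (d : Order.disp_t) (P : porderType d) (a b w : P) :
  ubound [set a; b] w <-> a <= w /\ b <= w.
Proof.
split=> [abw|[aw bw] _ [->|->]//].
by split; apply: abw; [left|right].
Qed.

Theorem theorem2 (d : Order.disp_t) (P : tbPOrderType d) (c : P -> P)
  (h1 : forall x y : P,
    lbound [set x] `<=` lbound (ubound (lbound [set x; y] `|` [set c y])))
  (h2 : forall x y : P,
    lbound (ubound [set x; c y] `|` [set y]) `<=` lbound [set x]) :
  operator_residuated c
    (fun x y : P => lbound [set x; y])
    (fun x y : P => lbound (ubound [set y; c x])).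
Proof.
have comm (x y : P) : lbound [set x; y] = lbound [set y; x] by rewrite setUC.
have unit_r (x : P) : lbound [set x; \top] = lbound [set x].
  apply/seteqP; split=> w; first by case/lbound2P=> wx _; apply/lbound1P.
  by move/lbound1P=> wx; apply/lbound2P; rewrite lex1.
split=> //; split=> [x|x y z|x].
- by rewrite (comm \top).
- split=> [xyz w wx u /ubound2P[zu cyu]|xR w /lbound2P[wx wy]].
    (* Since $L(x,y)\subseteq L(z)$, any [u] above $z$ and $y'$ bounds $L(x,y)\cup\{y'\}$, so [h1]
       gives $w\leq u$. *)
    apply: (h1 x y w wx) => v [/xyz /lbound1P vz|->//].
    exact: le_trans vz zu.
  (* Here [w] lies in $L(U(z,y'),y)$: below $U(z,y')$ because $w\leq x$, and below $y$. *)
  apply: (h2 z y) => u [|->//]; apply: xR.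
  exact/lbound1P.
- apply/seteqP; split=> w.
    (* $x'$ itself belongs to $U(0,x')$. *)
    by move=> wR; apply/lbound1P/wR/ubound2P; rewrite le0x.
  by move/lbound1P=> wx u /ubound2P[_]; apply: le_trans.
Qed.
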